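(* Every DMGrp-space $X=\langle X;g,S,\Theta,\tau\rangle$ is relationally isomorphic to $\mathcal{F}_0(\mathcal{G}_0(X))$; that is, there is a bijection $f\colon X\to\mathfrak{P}(\Omega(X))$ such that for all $x,y,z\in X$, $Sxyz$ if and only if $S_{\Omega(X)}f(x)f(y)f(z)$.
   Context: For a topological space $X$, $\Omega(X)$ is the set of compact open subsets of $X$, and the specialization order is: $x\leqslant y$ iff every open set containing $x$ contains $y$. A spectral space is a compact, $T_0$, sober space $X$ such that $\Omega(X)$ is closed under finite intersections and is a basis for $X$ (sober: every completely prime filter of the lattice of open sets is the set of open neighbourhoods of some point). A De Morgan spectral space is $\langle X;g,\tau\rangle$ where $\langle X;\tau\rangle$ is a spectral space, $g\colon X\to X$ is an order-inverting involution for $\leqslant$, and $U^*:=\{x\in X:g(x)\notin U\}\in\Omega(X)$ for every $U\in\Omega(X)$. For $S\subseteq X^3$ and $U,V\subseteq X$ let $U\circ V=\{z\in X:\exists x,y\,(Sxyz,\ x\in U,\ y\in V)\}$ and $U\rightarrow V=\{x\in X:\forall y,z\,((Sxyz\ \text{and}\ y\in U)\Rightarrow z\in V)\}$. A DMGrp-space is $\langle X;g,S,\Theta,\tau\rangle$, with $S\subseteq X^3$ and $\Theta\subseteq X$, such that: (1) $\langle X;g,\tau\rangle$ is a De Morgan spectral space; (2) $U,V\in\Omega(X)$ implies $U\circ V\in\Omega(X)$ and $U\rightarrow V\in\Omega(X)$; (3) $Sxyz$, $x'\leqslant x$, $y'\leqslant y$, $z\leqslant z'$ imply $Sx'y'z'$;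 (4) if not $Sxyz$, there are $U,V\in\Omega(X)$ with $x\in U$, $y\in V$, $z\notin U\circ V$; (5) $\Theta\in\Omega(X)$ and for all $y,z$: $y\leqslant z$ iff there is $x\in\Theta$ with $Sxyz$. $\mathcal{G}_0(X)=\langle\Omega(X);\cap,\cup,{}^*,\circ,\rightarrow,\Theta,\emptyset,X\rangle$. The underlying set of its prime spectrum $\mathcal{F}_0(\mathcal{G}_0(X))$ is the set $\mathfrak{P}(\Omega(X))$ of prime (in particular proper) filters of the lattice $\Omega(X)$, with ternary relation $S_{\Omega(X)}\mathscr{X}\mathscr{Y}\mathscr{Z}$ iff $\mathscr{X}\odot\mathscr{Y}\subseteq\mathscr{Z}$, where $\mathscr{X}\odot\mathscr{Y}=\{W\in\Omega(X):U\circ V\subseteq W\text{ for some }U\in\mathscr{X},\ V\in\mathscr{Y}\}$. *)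

(* Defs.v *)
From mathcomp Require Import all_boot all_order.
From mathcomp Require Import boolp classical_sets functions topology.

Set Implicit Arguments.
Unset Strict Implicit.
Unset Printing Implicit Defensive.

Local Open Scope classical_set_scope.

Section SetLattices.
Variable T : Type.

(* Lattices of subsets of T under intersection and union are given by their
   carrier L : set (set T); subsets of L are again families of sets. *)
Implicit Types (L F G H : set (set T)) (op : set T -> set T -> set T).

Definition lattice_filter L F :=
  [/\ F `<=` L,
      F !=set0,
      (forall U V, L V -> F U -> U `<=` V -> F V) &
      setI_closed F].

Definition prime_filter L F :=
  [/\ lattice_filter L F,
      F `<` L &
      forall U V, L U -> L V -> F (U `|` V) -> F U \/ F V].

(* The family D may be empty, so that set0 is not in F and F is proper. *)
Definition completely_prime_filter L F :=
  lattice_filter L F /\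
  forall D, D `<=` L -> F (\bigcup_(U in D) U) -> exists2 U, D U & F U.

Definition prime_spectrum L : set (set (set T)) := [set F | prime_filter L F].

Definition filter_product L op F G : set (set T) :=
  [set W | L W /\ exists U V, [/\ F U, G V & op U V `<=` W]].

Definition spectrum_rel L op F G H := filter_product L op F G `<=` H.

End SetLattices.

Section Spaces.
Variable X : topologicalType.
Implicit Types (g : X -> X) (S : X -> X -> X -> Prop) (U V Theta : set X).

Definition co_lattice : set (set X) := [set U | compact U /\ open U].

Definition specialization (x y : X) := forall U, open U -> U x -> U y.

Definition sober := forall F : set (set X),
  completely_prime_filter open F -> exists x, F = [set U | open U /\ U x].

(* compact [set: X] makes co_lattice closed under the empty intersection *)
Definition spectral_space :=
  [/\ compact [set: X],
      kolmogorov_space X,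
      sober,
      setI_closed co_lattice &
      basis co_lattice].

Definition dm_star g U : set X := [set x | ~ U (g x)].

Definition de_morgan_spectral_space g :=
  [/\ spectral_space,
      involutive g,
      (forall x y, specialization x y -> specialization (g y) (g x)) &
      forall U, co_lattice U -> co_lattice (dm_star g U)].

Definition fusion S U V : set X :=
  [set z | exists x y, [/\ S x y z, U x & V y]].

Definition residual S U V : set X :=
  [set x | forall y z, S x y z /\ U y -> V z].

Record DMGrp_space g S Theta : Prop := {
  dmgrp_spectral : de_morgan_spectral_space g;
  dmgrp_ops : forall U V, co_lattice U -> co_lattice V ->
    co_lattice (fusion S U V) /\ co_lattice (residual S U V);
  dmgrp_mono : forall x y z x' y' z', S x y z ->
    specialization x' x -> specialization y' y -> specialization z z' ->
    S x' y' z';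
  dmgrp_sep : forall x y z, ~ S x y z ->
    exists U V, [/\ co_lattice U, co_lattice V, U x, V y &
                    ~ fusion S U V z];
  dmgrp_unit_compact_open : co_lattice Theta;
  dmgrp_unit : forall y z,
    specialization y z <-> exists2 x, Theta x & S x y z }.

End Spaces.

Arguments co_lattice X : clear implicits.

(* Main.v *)
Require Import Defs.
From mathcomp Require Import all_boot all_order.
From mathcomp Require Import boolp classical_sets functions topology.

Local Open Scope classical_set_scope.

(** A point [x] is sent to the prime filter of its compact open
neighbourhoods.  This map is injective because the compact open sets form a
basis of a [T_0] space.  For surjectivity, the open sets above a member of a
prime filter [F] form a completely prime filter, which sobriety represents by
a point.  The map reflects the ternary relation by the separation axiom (4). *)

Definition co_nbhs (X : topologicalType) (x : X) : set (set X) :=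
  [set U | co_lattice X U /\ U x].

Definition open_upclosure (X : topologicalType) (F : set (set X)) :
    set (set X) :=
  [set W | open W /\ exists2 U, F U & U `<=` W].

Lemma co_lattice0 (X : topologicalType) : co_lattice X set0.
Proof. by split; [exact: compact0 | exact: open0]. Qed.

Lemma co_latticeU (X : topologicalType) (U V : set X) :
  co_lattice X U -> co_lattice X V -> co_lattice X (U `|` V).
Proof. by move=> [cU oU] [cV oV]; split; [exact: compactU | exact: openU]. Qed.

Lemma prime_filter_co_lattice0 (X : topologicalType) (F : set (set X)) :
  prime_filter (co_lattice X) F -> ~ F set0.
Proof.
move=> [[_ _ Fup _] [_ FnL] _] F0; apply: FnL => U LU.
exact: Fup LU F0 (@sub0set _ U).
Qed.

Lemma co_basis_sub (X : topologicalType) (x : X) (A : set X) :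
  basis (co_lattice X) -> nbhs x A ->
  exists U, [/\ co_lattice X U, U x & U `<=` A].
Proof. by move=> [_ LX] /LX[U [LU Ux] UA]; exists U. Qed.

(** Compactness of the space puts [setT] in the family; [set0] is compact open and contains no
    point, so the family is proper. *)
Lemma co_nbhs_prime_filter (X : topologicalType) (x : X) :
  compact [set: X] -> setI_closed (co_lattice X) ->
  prime_filter (co_lattice X) (co_nbhs X x).
Proof.
move=> cX LI; split; [split|split|].
- by move=> U [].
- by exists setT; split=> //; split=> //; exact: openT.
- by move=> U V LV [_ Ux] UV; split=> //; exact: UV.
- by move=> U V [LU Ux] [LV Vx]; split; [exact: LI | split].
- by move=> U [].
- by move=> /(_ _ (co_lattice0 X))[].
- by move=> U V LU LV [_ [Ux|Vx]]; [left | right].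
Qed.

Lemma co_nbhs_inj (X : topologicalType) :
  kolmogorov_space X -> basis (co_lattice X) -> injective (co_nbhs X).
Proof.
move=> T0 LX.
(* A basic set between [x] and [A] also contains [y], so no neighbourhood separates points with
   equal images. *)
have sep x y A : co_nbhs X x = co_nbhs X y -> nbhs x A -> A y.
  move=> xy /(co_basis_sub X x A LX)[U [LU Ux UA]]; apply: UA.
  by have : co_nbhs X x U by []; rewrite xy => -[].
move=> x y xy; apply/eqP/negP => /negP /T0[A].
by case=> -[/set_mem Ax /set_mem]; apply; apply: sep Ax.
Qed.

(** The sets [U `\` V] with [V] a compact open set outside of [F] generate a
proper filter since [F] is prime, and any cluster point of it in [U] works. *)
Lemma prime_filter_co_point (X : topologicalType) (F : set (set X))
    (U : set X) :
  prime_filter (co_lattice X) F -> F U ->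
  exists2 x, U x & co_nbhs X x `<=` F.
Proof.
move=> pF FU; have nF0 := prime_filter_co_lattice0 X F pF.
have [[FL _ Fup _] _ FU_prime] := pF.
pose G := filter_from [set V | co_lattice X V /\ ~ F V] (fun V => U `\` V).
have GF : ProperFilter G.
  apply: filter_from_proper; first apply: filter_from_filter.
  - by exists set0; split=> //; exact: co_lattice0.
  - move=> V W [LV nFV] [LW nFW]; exists (V `|` W); last by rewrite setDUr.
    by split; [exact: co_latticeU | case/FU_prime].
  (* If the difference were empty, [U] would lie in [V], forcing [F V]. *)
  - move=> V [LV nFV]; apply: contra_notP nFV => U0.
    apply: Fup LV FU _ => z Uz; apply: contra_notP U0 => nVz.
    by exists z.
have [|x [Ux xG]] := (FL U FU).1 G GF.
  by exists set0; [split=> //; exact: co_lattice0 | rewrite setD0].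
(* If [W] were outside [F], it would be a neighbourhood of the cluster point missing a member of
   [G]. *)
exists x => // W [LW Wx]; apply: contrapT => nFW.
have GUW : G (U `\` W) by exists W.
have [z [[_ nWz] Wz]] := xG _ W GUW (open_nbhs_nbhs (conj LW.2 Wx)).
exact: nWz.
Qed.

(** If the union of [D] contains some [U] in [F], then some [B] in [D] contains a point of [U] whose
    compact open neighbourhoods all lie in [F]. One of them fits inside [B]. *)
Lemma open_upclosure_completely_prime (X : topologicalType)
    (F : set (set X)) :
  basis (co_lattice X) -> prime_filter (co_lattice X) F ->
  completely_prime_filter open (open_upclosure X F).
Proof.
move=> LX pF; have [[FL [U0 FU0] Fup FI] _ _] := pF; split; first split.
- by move=> W [].
- by exists U0; split; [exact: (FL _ FU0).2 | exists U0].
- move=> V W oW [_ [U FU UV]] VW; split=> //.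
  by exists U => //; exact: subset_trans VW.
- move=> V W [oV [U FU UV]] [oW [U' FU' UW]]; split; first exact: openI.
  by exists (U `&` U'); [exact: FI | exact: setISS].
- move=> D oD [_ [U FU UD]].
  have [x Ux xF] := prime_filter_co_point X F U pF FU.
  have [B DB Bx] := UD x Ux.
  have nB : nbhs x B by apply: open_nbhs_nbhs; split=> //; exact: oD.
  have [W [LW Wx WB]] := co_basis_sub X x B LX nB.
  by exists B => //; split; [exact: oD | exists W => //; exact: xF].
Qed.

(** A compact open set above a member of [F] is already in [F], so [F] is the compact open part of
    its open up-closure. *)
Lemma co_nbhs_surj (X : topologicalType) (F : set (set X)) :
  sober X -> basis (co_lattice X) -> prime_filter (co_lattice X) F ->
  exists x, co_nbhs X x = F.
Proof.
move=> sX LX pF; have [[FL _ Fup _] _ _] := pF.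
have [x xF] := sX _ (open_upclosure_completely_prime X F LX pF).
exists x; rewrite eqEsubset; split=> U.
- move=> [LU Ux].
  have [_ [V FV VU]] : open_upclosure X F U.
    by rewrite xF; split=> //; exact: LU.2.
  exact: Fup LU FV VU.
- move=> FU; have LU := FL _ FU; split=> //.
  have : open_upclosure X F U by split; [exact: LU.2 | exists U].
  by rewrite xF => -[].
Qed.

Theorem theorem4p13 (X : topologicalType) (g : X -> X)
    (S : X -> X -> X -> Prop) (Theta : set X) (hX : DMGrp_space g S Theta) :
  exists f : X -> set (set X),
    set_bij [set: X] (prime_spectrum (co_lattice X)) f /\
    forall x y z : X,
      S x y z <->
      spectrum_rel (co_lattice X) (fusion S) (f x) (f y) (f z).
Proof.
have [[[cX T0 sX LI LX] _ _ _] ops _ sep _ _] := hX.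
exists (co_nbhs X); split; first split.
- by move=> x _; exact: co_nbhs_prime_filter.
- by move=> x y _ _; exact: co_nbhs_inj.
- by move=> F /(co_nbhs_surj X F sX LX)[x <-]; exists x.
move=> x y z; split.
- move=> Sxyz W [LW [U [V [[_ Ux] [_ Vy] UVW]]]]; split=> //.
  by apply: UVW; exists x, y.
(* The separating [fusion S U V] is compact open, so it lies in the product of the filters of [x]
   and [y], hence contains [z]. *)
- move=> xyz; apply: contrapT => /sep[U [V [LU LV Ux Vy]]]; apply.
  suff : co_nbhs X z (fusion S U V) by case.
  apply: xyz; split; first exact: (ops U V LU LV).1.
  by exists U, V; split; [split | split | ].
Qed.
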